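(* Let $A$ be a non-empty subset of $\mathbb{N}$ and let $F$ be a positive integer. Then $\mathscr{I}(A,F)\neq\emptyset$ if and only if $F\notin\langle A\rangle$.
   Context: $\mathbb{N}=\{0,1,2,\ldots\}$. $\langle A\rangle$ is the submonoid of $(\mathbb{N},+)$ generated by $A$. A numerical semigroup is a submonoid $S$ of $(\mathbb{N},+)$ with $\mathbb{N}\setminus S$ finite; its Frobenius number $\mathrm{F}(S)$ is the greatest integer not belonging to $S$. A numerical semigroup is irreducible if it cannot be expressed as the intersection of two numerical semigroups containing it strictly. $\mathscr{I}(A,F)$ is the set of all irreducible numerical semigroups $S$ such that $A\subseteq S$ and $\mathrm{F}(S)=F$. *)

(* Defs.v *)
From mathcomp Require Import all_boot all_order all_algebra.
From mathcomp Require Import classical_sets cardinality.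

Set Implicit Arguments.
Unset Strict Implicit.
Unset Printing Implicit Defensive.

Local Open Scope classical_set_scope.

Definition submonoid (M : set nat) : Prop :=
  M 0 /\ forall x y, M x -> M y -> M (x + y).

Definition generated_submonoid (A : set nat) : set nat := smallest submonoid A.

Definition numerical_semigroup (S : set nat) : Prop :=
  submonoid S /\ finite_set (~` S).

(* The maximum is taken over all integers, so the Frobenius number of
   [set: nat] is -1. *)
Definition is_frobenius_number (S : set nat) (f : int) : Prop :=
  ~ (Posz @` S) f /\ forall z : int, ~ (Posz @` S) z -> (z <= f)%R.

Definition irreducible_semigroup (S : set nat) : Prop :=
  numerical_semigroup S /\
  ~ exists S1 S2 : set nat,
      [/\ numerical_semigroup S1, numerical_semigroup S2,
          S `<` S1, S `<` S2 & S = S1 `&` S2].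

Definition irreducible_semigroups (A : set nat) (F : nat) : set (set nat) :=
  [set S | [/\ irreducible_semigroup S, A `<=` S & is_frobenius_number S F%:Z]].

(* Main.v *)
Require Import Defs.
From mathcomp Require Import all_boot all_order all_algebra.
From mathcomp Require Import classical_sets cardinality.
From mathcomp Require Import boolp.

(** A semigroup with Frobenius number [F] that contains [A] contains [<A>] and
    misses [F], which gives one direction.  For the other one, adjoin to [<A>]
    all integers greater than [F]: the result is a submonoid that still misses
    [F], and by Zorn's lemma it extends to a submonoid [S] that is maximal among
    those missing [F] ([maximal_submonoid_avoiding]).  Every submonoid
    containing the integers greater than [F] has a finite complement, so [S] is
    a numerical semigroup, and its Frobenius number is [F].  It is irreducible
    because, by maximality, every semigroup strictly larger than [S] contains
    [F], hence so does the intersection of two of them, which therefore is not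
    [S] ([maximal_avoiding_irreducible]). *)

Local Open Scope classical_set_scope.

Lemma submonoid_generated (A : set nat) : submonoid (generated_submonoid A).
Proof.
split=> [M [[]]// | x y Ax Ay M MA].
by case: (MA) => -[_ addM] _; apply: addM; [apply: Ax | apply: Ay].
Qed.

Lemma generated_submonoid_min (A M : set nat) :
  submonoid M -> A `<=` M -> generated_submonoid A `<=` M.
Proof. by move=> subM AM; apply: smallest_sub. Qed.

(** Beyond [n] there is an additive ideal of the monoid of natural numbers, so
    sums involving one of its elements stay in it. *)
Lemma submonoid_setU_gt (M : set nat) (n : nat) :
  submonoid M -> submonoid (M `|` [set m | n < m]).
Proof.
move=> [M0 addM]; split=> [|x y]; first by left.
move=> [Mx|/= ltx] [My|/= lty]; first by left; apply: addM.
- by right; rewrite /= ltn_addl.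
- by right; rewrite /= ltn_addr.
- by right; rewrite /= ltn_addr.
Qed.

Lemma finite_setC_gt (S : set nat) (n : nat) :
  [set m | n < m] `<=` S -> finite_set (~` S).
Proof.
move=> gtS; apply: (sub_finite_set _ (finite_II n.+1)) => m /= nSm.
by rewrite ltnS leqNgt; apply/negP => /gtS.
Qed.

Lemma maximal_submonoid_avoiding (M : set nat) (F : nat) :
  submonoid M -> ~ M F ->
  exists S : set nat, [/\ submonoid S, M `<=` S, ~ S F &
    forall T, submonoid T -> S `<` T -> T F].
Proof.
move=> [M0 addM] nMF.
(* The property bears on [M `|` X] rather than on [X], so that it also holds of
   the union of the empty chain. *)
pose P := [set X : set nat | submonoid (M `|` X) /\ ~ (M `|` X) F].
have [C CP Ctot|X [[subS nSF] maxX]] := @Zorn_bigcup nat P.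
  have inU X x : C X -> (M `|` X) x -> (M `|` \bigcup_(X in C) X) x.
    by move=> CX [Mx|Xx]; [left | right; exists X].
  split; last by move=> [//|[X CX XF]]; have [_] := CP _ CX; apply; right.
  split=> [|x y]; first by left.
  move=> [Mx|[X CX Xx]] [My|[Y CY Yy]]; first by left; apply: addM.
  - have [[_ addY] _] := CP _ CY.
    by apply: (inU Y) => //; apply: addY; [left|right].
  - have [[_ addX] _] := CP _ CX.
    by apply: (inU X) => //; apply: addX; [right|left].
  - have [XY|YX] := Ctot _ _ CX CY.
    + have [[_ addY] _] := CP _ CY; apply: (inU Y) => //.
      by apply: addY; right=> //; apply: XY.
    + have [[_ addX] _] := CP _ CX; apply: (inU X) => //.
      by apply: addX; right=> //; apply: YX.
exists (M `|` X); split=> // T subT [ST nTS].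
have MT : M `|` T = T by apply/setUidPr => x Mx; apply: ST; left.
apply: contrapT => nTF; apply: (maxX T); last by rewrite /P /mkset MT.
by split=> [x Xx|TX]; [apply: ST; right | apply: nTS => x /TX; right].
Qed.

Lemma maximal_avoiding_irreducible (S : set nat) (F : nat) :
  numerical_semigroup S -> ~ S F ->
  (forall T, submonoid T -> S `<` T -> T F) -> irreducible_semigroup S.
Proof.
move=> semS nSF maxS; split=> // -[S1 [S2 [[sub1 _] [sub2 _] lt1 lt2 defS]]].
by apply: nSF; rewrite defS; split; apply: maxS.
Qed.

Lemma is_frobenius_number_nat (S : set nat) (F : nat) :
  ~ S F -> [set m | F < m] `<=` S -> is_frobenius_number S F%:Z.
Proof.
move=> nSF gtS; split=> [[m Sm [mF]]|[m|m] nSm //]; first by rewrite -mF in nSF.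
rewrite lez_nat leqNgt; apply/negP => /gtS Sm.
by apply: nSm; exists m.
Qed.

Theorem proposition3p3 (A : set nat) (F : nat) (hA : A !=set0) (hF : (0 < F)%N) :
  irreducible_semigroups A F !=set0 <-> ~ generated_submonoid A F.
Proof.
split=> [[S [[[subS _] _] AS [nSF _]]] genF|ngenF].
  by apply: nSF; exists F => //; apply: generated_submonoid_min genF.
have nMF : ~ (generated_submonoid A `|` [set m | F < m]) F.
  by move=> [//|/=]; rewrite ltnn.
have [S [subS MS nSF maxS]] := maximal_submonoid_avoiding _ _
  (submonoid_setU_gt _ F (submonoid_generated A)) nMF.
have gtS : [set m | F < m] `<=` S by move=> m Fm; apply: MS; right.
exists S; split.
- apply: maximal_avoiding_irreducible nSF maxS.
  by split=> //; apply: finite_setC_gt gtS.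
- by move=> x Ax; apply: MS; left=> M [_]; apply.
- exact: is_frobenius_number_nat.
Qed.
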